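(* Let $R$ be a commutative Noetherian local ring. Then, with the conditions $\mathsf{(AC)}$, $\mathsf{(SAC)}$, $\mathsf{(SACC)}$, $\mathsf{(ARC)}$, $\mathsf{(GARC)}$ on $R$ defined in the context: (i) if $R$ satisfies $\mathsf{(AC)}$, then $R$ satisfies $\mathsf{(SAC)}$; (ii) $R$ satisfies $\mathsf{(SAC)}$ if and only if $R$ satisfies $\mathsf{(GARC)}$; (iii) if $R$ satisfies $\mathsf{(SAC)}$, then $R$ satisfies $\mathsf{(SACC)}$; (iv) if $R$ has positive depth and satisfies $\mathsf{(SACC)}$, then $R$ satisfies $\mathsf{(ARC)}$.
   Context: The conditions on a commutative Noetherian local ring $R$ are as follows. Here $\mathrm{Ext}^{>n}_R(M,N)=0$ means $\mathrm{Ext}^i_R(M,N)=0$ for all $i>n$, and $\mathrm{Ext}^{\gg 0}_R(M,N)=0$ means $\mathrm{Ext}^i_R(M,N)=0$ for all sufficiently large $i$. $\mathsf{(AC)}$: For every finitely generated $R$-module $M$ there exists a nonnegative integer $b_M$ such that for every finitely generated $R$-module $N$: if $\mathrm{Ext}^{\gg 0}_R(M,N)=0$, then $\mathrm{Ext}^{>b_M}_R(M,N)=0$. $\mathsf{(ARC)}$: For every finitely generated $R$-module $M$, if $\mathrm{Ext}^{>0}_R(M,M\oplus R)=0$, then $M$ is projective. $\mathsf{(GARC)}$: For every finitely generated $R$-module $M$, if there exists a nonnegative integer $n$ such that $\mathrm{Ext}^{>n}_R(M,M\oplus R)=0$, then $M$ has projective dimension at most $n$. $\mathsf{(SAC)}$: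 For every finitely generated $R$-module $M$, if $\mathrm{Ext}^{>0}_R(M,R)=0$ and $\mathrm{Ext}^{\gg 0}_R(M,M)=0$, then $\mathrm{Ext}^{>0}_R(M,M)=0$. $\mathsf{(SACC)}$: For every finitely generated $R$-module $M$ that has constant rank, if $\mathrm{Ext}^{>0}_R(M,R)=0$ and $\mathrm{Ext}^{\gg 0}_R(M,M)=0$, then $\mathrm{Ext}^{>0}_R(M,M)=0$. A module $M$ has constant rank if there is an integer $r$ such that $M_p\cong R_p^{(r)}$ (free of rank $r$) for all associated primes $p$ of $R$. *)

(* Defs.v *)
From HB Require Import structures.
From mathcomp Require Import all_boot all_algebra.
From mathcomp Require Import ring_quotient generic_quotient.
From mathcomp Require Import boolp.
From mathcomp Require Import ring.

Set Implicit Arguments.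
Unset Strict Implicit.
Unset Printing Implicit Defensive.

Import GRing.Theory.
Local Open Scope ring_scope.
Local Open Scope quotient_scope.

Section Modules.
Variable R : comNzRingType.

Definition finitely_generated (M : lmodType R) : Prop :=
  exists (n : nat) (g : 'I_n -> M),
    forall x : M, exists c : 'I_n -> R, x = \sum_(i < n) c i *: g i.

Definition projective (P : lmodType R) : Prop :=
  forall (A B : lmodType R) (g : {linear A -> B}) (f : {linear P -> B}),
    (forall b, exists a, g a = b) ->
    exists h : {linear P -> A}, forall x, g (h x) = f x.

Record proj_resolution (M : lmodType R) := ProjResolution {
  res_mod :> nat -> lmodType R;
  res_diff : forall i, {linear res_mod i.+1 -> res_mod i};
  res_aug : {linear res_mod 0 -> M};
  res_proj : forall i, projective (res_mod i);
  res_aug_surj : forall m, exists x, res_aug x = m;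
  res_exact0 : forall x, res_aug x = 0 <-> exists y, res_diff 0 y = x;
  res_exact : forall i (x : res_mod i.+1),
    res_diff i x = 0 <-> exists y, res_diff i.+1 y = x
}.

Definition cocycle (M N : lmodType R) (P : proj_resolution M) (i : nat)
    (f : {linear P i -> N}) : Prop :=
  forall x, f (res_diff P i x) = 0.

Definition coboundary (M N : lmodType R) (P : proj_resolution M) (i : nat) :
    {linear P i -> N} -> Prop :=
  match i return {linear P i -> N} -> Prop with
  | 0 => fun f => forall x, f x = 0
  | j.+1 => fun f =>
      exists g : {linear P j -> N}, forall x, f x = g (res_diff P j x)
  end.

(* Ext^i_R(M, N) = 0, i.e. H^i(Hom_R(P, N)) = 0. The cohomology does not depend
   on the projective resolution P, so asking for one P is no restriction. *)
Definition Ext_zero (i : nat) (M N : lmodType R) : Prop :=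
  exists P : proj_resolution M,
    forall f : {linear P i -> N}, cocycle f -> coboundary f.

Definition Ext_zero_above (n : nat) (M N : lmodType R) : Prop :=
  forall i, (n < i)%N -> Ext_zero i M N.

Definition Ext_zero_eventually (M N : lmodType R) : Prop :=
  exists n, Ext_zero_above n M N.

Definition proj_dim_le (n : nat) (M : lmodType R) : Prop :=
  exists P : proj_resolution M, forall i, (n < i)%N -> forall x : P i, x = 0.

End Modules.

Section Ideals.
Variable R : comNzRingType.

Definition ideal_span (n : nat) (g : 'I_n -> R) (x : R) : Prop :=
  exists c : 'I_n -> R, x = \sum_(i < n) c i * g i.

(* [idealr R] only contains the proper ideals, but the unit ideal is always
   generated by 1. *)
Definition noetherian : Prop :=
  forall I : idealr R, exists (n : nat) (g : 'I_n -> R),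
    forall x, x \in (I : pred R) <-> ideal_span g x.

Definition maximal_ideal (I : idealr R) : Prop :=
  forall J : idealr R, {subset (I : pred R) <= (J : pred R)} ->
    {subset (J : pred R) <= (I : pred R)}.

Definition local_ring (m : idealr R) : Prop :=
  maximal_ideal m /\
  forall I : idealr R, maximal_ideal I -> (I : pred R) =i (m : pred R).

(* a_i is a nonzerodivisor on R / (a_0, .., a_(i-1)), and R / (a) is nonzero. *)
Definition regular_sequence (n : nat) (a : 'I_n -> R) : Prop :=
  let initial (i : 'I_n) :=
    ideal_span (fun j : 'I_i => a (widen_ord (ltnW (ltn_ord i)) j)) in
  (forall (i : 'I_n) (x : R), initial i (x * a i) -> initial i x) /\
  ~ ideal_span a 1.

(* d is the supremum of the lengths of the regular sequences contained in m. *)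
Definition has_depth (m : idealr R) (d : nat) : Prop :=
  let regular_in n := exists a : 'I_n -> R,
    regular_sequence a /\ forall i, a i \in (m : pred R) in
  regular_in d /\ forall n, regular_in n -> (n <= d)%N.

(* p is the annihilator of x. *)
Definition associated_prime (p : prime_idealr R) : Prop :=
  exists x : R, forall a, (a \in (p : pred R)) = (a * x == 0).

End Ideals.

Section Localization.
Variables (R : comNzRingType) (p : prime_idealr R).

Record denominator :=
  Denominator { den : R; den_notin : den \notin (p : pred R) }.
HB.instance Definition _ := [isSub for den].
HB.instance Definition _ := [Choice of denominator by <:].

Lemma denominator1_subproof : 1 \notin (p : pred R).
Proof. by rewrite idealr1. Qed.

Lemma denominatorM_subproof (s t : denominator) :
  den s * den t \notin (p : pred R).
Proof. by rewrite prime_idealrM negb_or !den_notin. Qed.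

Definition denominator1 : denominator := Denominator denominator1_subproof.
Definition denominatorM (s t : denominator) : denominator :=
  Denominator (denominatorM_subproof s t).

(* M_p is the set of fractions m / s with s outside p, where m / s = n / t iff
   u t m = u s n for some u outside p; it is a module over R_p = (R^o)_p. *)
Section Module.
Variable M : lmodType R.
Implicit Types x y z : M * denominator.

Definition loc_equiv x y : bool :=
  `[< exists u : denominator,
        den u *: (den y.2 *: x.1) = den u *: (den x.2 *: y.1) >].

Lemma loc_equiv_refl : reflexive loc_equiv.
Proof. by move=> x; apply/asboolP; exists denominator1. Qed.

Lemma loc_equiv_sym : symmetric loc_equiv.
Proof.
by move=> x y; apply/asboolP/asboolP => -[u eu]; exists u; rewrite eu.
Qed.

Lemma loc_equiv_trans : transitive loc_equiv.
Proof.
move=> y x z /asboolP[u eu] /asboolP[v ev]; apply/asboolP.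
exists (denominatorM (denominatorM u v) y.2) => /=.
transitivity ((den v * den z.2) *: (den u *: (den y.2 *: x.1))).
  by rewrite !scalerA; congr (_ *: _); ring.
transitivity ((den u * den x.2) *: (den v *: (den z.2 *: y.1))).
  by rewrite eu !scalerA; congr (_ *: _); ring.
by rewrite ev !scalerA; congr (_ *: _); ring.
Qed.

Canonical loc_equiv_equiv :=
  EquivRel loc_equiv loc_equiv_refl loc_equiv_sym loc_equiv_trans.

Definition localization : Type := {eq_quot loc_equiv}.
HB.instance Definition _ : EqQuotient _ loc_equiv localization :=
  EqQuotient.on localization.
HB.instance Definition _ := Choice.on localization.

Definition loc_frac (m : M) (s : denominator) : localization :=
  \pi_localization (m, s).

Lemma loc_fracP m s n t :
  loc_frac m s = loc_frac n t <->
  exists u : denominator, den u *: (den t *: m) = den u *: (den s *: n).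
Proof.
by split=> [/eqmodP/asboolP|/asboolP h]; [|apply/eqmodP].
Qed.

Lemma loc_ind (K : localization -> Prop) :
  (forall m s, K (loc_frac m s)) -> forall x : localization, K x.
Proof. by move=> h x; rewrite -[x]reprK; case: (repr x) => m s; exact: h. Qed.

Definition loc_add (x y : localization) : localization :=
  loc_frac (den (repr y).2 *: (repr x).1 + den (repr x).2 *: (repr y).1)
    (denominatorM (repr x).2 (repr y).2).

Definition loc_opp (x : localization) : localization :=
  loc_frac (- (repr x).1) (repr x).2.

Definition loc_zero : localization := loc_frac 0 denominator1.

Lemma repr_loc_frac m s : exists u : denominator,
  den u *: (den s *: (repr (loc_frac m s)).1)
  = den u *: (den (repr (loc_frac m s)).2 *: m).
Proof. by apply/loc_fracP; rewrite /loc_frac -surjective_pairing reprK. Qed.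

Lemma loc_addE m s n t :
  loc_add (loc_frac m s) (loc_frac n t) =
  loc_frac (den t *: m + den s *: n) (denominatorM s t).
Proof.
have [u eu] := repr_loc_frac m s; have [v ev] := repr_loc_frac n t.
rewrite /loc_add; move: (repr (loc_frac m s)) (repr (loc_frac n t)) eu ev => [m' s'] [n' t'] /= eu ev.
apply/loc_fracP; exists (denominatorM u v) => /=; rewrite !scalerDr.
congr (_ + _).
  transitivity ((den v * den t * den t') *: (den u *: (den s *: m'))).
    by rewrite !scalerA; congr (_ *: _); ring.
  by rewrite eu !scalerA; congr (_ *: _); ring.
transitivity ((den u * den s * den s') *: (den v *: (den t *: n'))).
  by rewrite !scalerA; congr (_ *: _); ring.
by rewrite ev !scalerA; congr (_ *: _); ring.
Qed.

Lemma loc_oppE m s : loc_opp (loc_frac m s) = loc_frac (- m) s.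
Proof.
have [u eu] := repr_loc_frac m s; rewrite /loc_opp; apply/loc_fracP; exists u.
by rewrite !scalerN eu.
Qed.

Lemma loc_addA : associative loc_add.
Proof.
elim/loc_ind=> m s; elim/loc_ind=> n t; elim/loc_ind=> k w.
rewrite !loc_addE; apply/loc_fracP; exists denominator1 => /=.
rewrite !scalerDr !scalerA !addrA.
by congr (_ *: _ + _ *: _ + _ *: _); ring.
Qed.

Lemma loc_addC : commutative loc_add.
Proof.
elim/loc_ind=> m s; elim/loc_ind=> n t.
rewrite !loc_addE; apply/loc_fracP; exists denominator1 => /=.
by rewrite !scalerDr !scalerA addrC; congr (_ *: _ + _ *: _); ring.
Qed.

Lemma loc_add0 : left_id loc_zero loc_add.
Proof.
elim/loc_ind=> m s; rewrite loc_addE; apply/loc_fracP; exists denominator1 => /=.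
by rewrite scaler0 add0r !scalerA; congr (_ *: _); ring.
Qed.

Lemma loc_addN : left_inverse loc_zero loc_opp loc_add.
Proof.
elim/loc_ind=> m s; rewrite loc_oppE loc_addE; apply/loc_fracP.
by exists denominator1; rewrite /= scalerN addNr !scaler0.
Qed.

HB.instance Definition _ :=
  GRing.isZmodule.Build localization loc_addA loc_addC loc_add0 loc_addN.

Lemma loc_fracD m s n t :
  loc_frac m s + loc_frac n t =
  loc_frac (den t *: m + den s *: n) (denominatorM s t).
Proof. exact: loc_addE. Qed.

End Module.

Definition localized_ring : Type := localization R^o.
HB.instance Definition _ := GRing.Zmodule.on localized_ring.

Definition ring_frac (a : R) (s : denominator) : localized_ring :=
  @loc_frac R^o a s.

Lemma ring_fracP a s b t :
  ring_frac a s = ring_frac b t <->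
  exists u : denominator, den u * (den t * a) = den u * (den s * b).
Proof. exact: loc_fracP. Qed.

Lemma ring_ind (K : localized_ring -> Prop) :
  (forall a s, K (ring_frac a s)) -> forall x, K x.
Proof. exact: (@loc_ind R^o). Qed.

Lemma ring_addE a s b t :
  ring_frac a s + ring_frac b t =
  ring_frac (den t * a + den s * b) (denominatorM s t).
Proof. exact: loc_addE. Qed.

Section Scale.
Variable M : lmodType R.

Definition loc_scale (a : localized_ring) (x : localization M) : localization M :=
  loc_frac ((repr a).1 *: (repr x).1) (denominatorM (repr a).2 (repr x).2).

Lemma loc_scaleE a s (m : M) t :
  loc_scale (ring_frac a s) (loc_frac m t) =
  loc_frac (a *: m) (denominatorM s t).
Proof.
have [u eu] := @repr_loc_frac R^o a s; have [v ev] := repr_loc_frac m t.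
rewrite /loc_scale /ring_frac.
move: (repr (loc_frac _ s)) (repr (loc_frac m t)) eu ev => [a' s'] [m' t'] /= eu ev.
apply/loc_fracP; exists (denominatorM u v) => /=.
transitivity ((den u * (den s * a')) *: (den v *: (den t *: m'))).
  by rewrite !scalerA; congr (_ *: _); ring.
have -> : den u * (den s * a') = den u * (den s' * a) by exact: eu.
by rewrite ev !scalerA; congr (_ *: _); ring.
Qed.

End Scale.

Definition ring_mul (a b : localized_ring) : localized_ring :=
  @loc_scale R^o a b.

Lemma ring_mulE a s b t :
  ring_mul (ring_frac a s) (ring_frac b t) =
  ring_frac (a * b) (denominatorM s t).
Proof. exact: loc_scaleE. Qed.

Definition ring_one : localized_ring := ring_frac 1 denominator1.

Lemma ring_mulA : associative ring_mul.
Proof.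
elim/ring_ind=> a s; elim/ring_ind=> b t; elim/ring_ind=> c w.
rewrite !ring_mulE; apply/ring_fracP; exists denominator1 => /=; ring.
Qed.

Lemma ring_mulC : commutative ring_mul.
Proof.
elim/ring_ind=> a s; elim/ring_ind=> b t.
rewrite !ring_mulE; apply/ring_fracP; exists denominator1 => /=; ring.
Qed.

Lemma ring_mul1 : left_id ring_one ring_mul.
Proof.
elim/ring_ind=> a s.
rewrite !ring_mulE; apply/ring_fracP; exists denominator1 => /=; ring.
Qed.

Lemma ring_mulD : left_distributive ring_mul +%R.
Proof.
elim/ring_ind=> a s; elim/ring_ind=> b t; elim/ring_ind=> c w.
rewrite ring_addE !ring_mulE ring_addE.
apply/ring_fracP; exists denominator1 => /=; ring.
Qed.

Lemma ring_one_neq0 : ring_one != 0.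
Proof.
apply/eqP => /ring_fracP[u] /=; rewrite !mulr1 !mulr0 => eu.
by have := den_notin u; rewrite eu idealr0.
Qed.

HB.instance Definition _ := GRing.Zmodule_isComNzRing.Build localized_ring
  ring_mulA ring_mulC ring_mul1 ring_mulD ring_one_neq0.

Section ModuleStructure.
Variable M : lmodType R.

Lemma loc_scaleA (a b : localized_ring) (x : localization M) :
  loc_scale a (loc_scale b x) = loc_scale (a * b) x.
Proof.
elim/ring_ind: a => a s; elim/ring_ind: b => b t; elim/loc_ind: x => m w.
rewrite [_ * _]ring_mulE !loc_scaleE; apply/loc_fracP; exists denominator1 => /=.
by rewrite !scalerA; congr (_ *: _); ring.
Qed.

Lemma loc_scale1 : left_id (1 : localized_ring) (@loc_scale M).
Proof.
elim/loc_ind=> m s; rewrite [X in loc_scale X]/(1) /= loc_scaleE.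
by apply/loc_fracP; exists denominator1; rewrite /= !scalerA; congr (_ *: _); ring.
Qed.

Lemma loc_scaleDr : right_distributive (@loc_scale M) +%R.
Proof.
elim/ring_ind=> a s; elim/loc_ind=> m t; elim/loc_ind=> n w.
rewrite loc_fracD !loc_scaleE loc_fracD.
apply/loc_fracP; exists denominator1 => /=.
by rewrite !scalerDr !scalerA; congr (_ *: _ + _ *: _); ring.
Qed.

Lemma loc_scaleDl (x : localization M) :
  {morph (@loc_scale M)^~ x : a b / a + b}.
Proof.
elim/ring_ind=> a s; elim/ring_ind=> b t; elim/loc_ind: x => m w.
rewrite ring_addE !loc_scaleE loc_fracD.
apply/loc_fracP; exists denominator1 => /=.
rewrite scalerDl !scalerDr !scalerA.
by congr (_ *: _ + _ *: _); ring.
Qed.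

HB.instance Definition _ := GRing.Zmodule_isLmodule.Build localized_ring
  (localization M) loc_scaleA loc_scale1 loc_scaleDr loc_scaleDl.

Lemma loc_fracZ a s (m : M) t :
  ring_frac a s *: loc_frac m t = loc_frac (a *: m) (denominatorM s t).
Proof. exact: loc_scaleE. Qed.

End ModuleStructure.

End Localization.

Section Conditions.
Variable R : comNzRingType.

Definition constant_rank (M : lmodType R) : Prop :=
  exists r : nat, forall p : prime_idealr R, associated_prime p ->
    exists f : {linear localization p M -> 'rV[localized_ring p]_r}, bijective f.

Definition cond_AC : Prop :=
  forall M : lmodType R, finitely_generated M ->
  exists b : nat, forall N : lmodType R, finitely_generated N ->
    Ext_zero_eventually M N -> Ext_zero_above b M N.

Definition cond_ARC : Prop :=
  forall M : lmodType R, finitely_generated M ->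
    Ext_zero_above 0 M (M * R^o)%type -> projective M.

Definition cond_GARC : Prop :=
  forall M : lmodType R, finitely_generated M ->
  forall n : nat, Ext_zero_above n M (M * R^o)%type -> proj_dim_le n M.

Definition cond_SAC : Prop :=
  forall M : lmodType R, finitely_generated M ->
    Ext_zero_above 0 M R^o -> Ext_zero_eventually M M -> Ext_zero_above 0 M M.

Definition cond_SACC : Prop :=
  forall M : lmodType R, finitely_generated M -> constant_rank M ->
    Ext_zero_above 0 M R^o -> Ext_zero_eventually M M -> Ext_zero_above 0 M M.

End Conditions.

(* Main.v *)
Require Import Defs.
From HB Require Import structures.
From mathcomp Require Import all_boot all_algebra.
From mathcomp Require Import ring_quotient generic_quotient.
From mathcomp Require Import boolp classical_sets.
From mathcomp Require Import ring.

(** Two mechanisms give all four claims.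

    Dimension shifting: if Ext^{>0}(M, R) = 0 and N' is a syzygy of N, then
    Ext^i(M, N) and Ext^{i+1}(M, N') agree for i > 0. Hence a bound b, uniform
    in N, on the degrees of the eventually vanishing Ext(M, N) can be lowered to
    0 ([Ext_zero_of_uniform_bound]). Condition (AC) provides such a bound; so does
    (GARC), in the form of the projective dimension of M, when Ext^i(M, M) = 0
    for large i.

    A pullback trick: call M rigid when Ext^{>0}(M, R) = 0 and Ext^i(M, M) = 0
    for large i. Let e : P0 -> M be a finite free cover with kernel K, let x be
    in the maximal ideal, and let X be the pullback of e along x : M -> M. Then
    X is an extension of M by K, so it is rigid as well
    ([Ext_zero_pullback], [eventually_pullback]). If moreover Ext^1(X, X) = 0,
    then M is projective ([projective_of_rigid_pullback]): the class of
    0 -> K -> P0 -> M -> 0 becomes trivial in Ext^1(X, X), and this yields a map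
    r : P0 -> K whose restriction to K is 1 - x S for some S. That restriction
    is bijective because R is local; so K is a direct summand of P0.

    - For x = 0 the pullback is the direct sum of K and M, and (SAC) makes every
      rigid module projective. A module M as in (GARC) has a rigid n-th syzygy,
      so its projective dimension is at most n.
    - For x regular, x is invertible at the associated primes, where X therefore
      becomes P0. So X has constant rank, (SACC) applies to it, and rigid
      modules are projective again, which is more than (ARC). *)

Set Implicit Arguments.
Unset Strict Implicit.
Unset Printing Implicit Defensive.

Import GRing.Theory.
Local Open Scope ring_scope.

(** * Linear maps, kernels and lifting *)

Section LinearMaps.
Variable R : comNzRingType.
Implicit Types A B C : lmodType R.

Definition pack_linear A B (f : A -> B) (lin_f : linear f) : {linear A -> B} :=
  HB.pack f (GRing.isLinear.Build R A B *:%R f lin_f).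

(** The tool for maps obtained by a diagram chase, which produces a relation
    rather than a formula. *)
Lemma linear_of_relation A B (G : A -> B -> Prop) :
  (forall a, exists b, G a b) ->
  (forall c a b a' b', G a b -> G a' b' -> G (c *: a + a') (c *: b + b')) ->
  (forall b, G 0 b -> b = 0) ->
  exists h : {linear A -> B}, forall a, G a (h a).
Proof.
move=> /choice[h hG] lin_G G0.
have lin_h : linear h.
  move=> c a a'; apply/eqP; rewrite -subr_eq0; apply/eqP/G0.
  have := lin_G (-1) _ _ _ _ (lin_G c _ _ _ _ (hG a) (hG a')) (hG (c *: a + a')).
  by rewrite !scaleN1r addNr [X in G 0 X -> _]addrC.
by exists (pack_linear lin_h).
Qed.

Section Kernel.
Variables (A B : lmodType R) (f : {linear A -> B}).

Definition ker_pred : {pred A} := fun a => f a == 0.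

Lemma ker_pred_submod : submod_closed ker_pred.
Proof.
split=> [|c u v]; rewrite !unfold_in ?linear0 // => /eqP fu /eqP fv.
by rewrite linearPZ fu fv scaler0 addr0.
Qed.
HB.instance Definition _ := GRing.isSubmodClosed.Build R A ker_pred
  (GRing.submod_closed_semi ker_pred_submod).

Record kernel := Kernel { kerval : A; _ : kerval \in ker_pred }.
HB.instance Definition _ := [isSub for kerval].
HB.instance Definition _ := [Choice of kernel by <:].
HB.instance Definition _ := [SubChoice_isSubLmodule of kernel by <:].

Definition ker_incl : {linear kernel -> A} := val.

Lemma ker_incl_inj : injective ker_incl. Proof. exact: val_inj. Qed.

Lemma ker_inclK k : f (ker_incl k) = 0.
Proof. by apply/eqP; case: k. Qed.

Lemma ker_inclP a : f a = 0 <-> exists k, ker_incl k = a.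
Proof.
split=> [/eqP fa | [k <-]]; last exact: ker_inclK.
by exists (@Kernel a fa).
Qed.
End Kernel.

Lemma lift_injective A B C (i : {linear A -> B}) (f : {linear C -> B}) :
  injective i -> (forall c, exists a, i a = f c) ->
  exists h : {linear C -> A}, forall c, i (h c) = f c.
Proof.
move=> inj_i surj.
apply: (@linear_of_relation _ _ (fun c a => i a = f c)) => // [k c a c' a' ia ia' | a].
  by rewrite !linearPZ ia ia'.
by rewrite linear0 -[RHS](linear0 i) => /inj_i.
Qed.

(** Only the image of [f] has to lie in that of [g]. The definition of
    projectivity is applied to the pullback of [f] and [g], which surjects
    onto [P]; this replaces the image of [g] as a module. *)
Lemma lift_projective (P : lmodType R) A B (g : {linear A -> B})
    (f : {linear P -> B}) :
  projective P -> (forall p, exists a, g a = f p) ->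
  exists h : {linear P -> A}, forall p, g (h p) = f p.
Proof.
move=> projP surj.
have lin_d : linear (fun u : P * A => f u.1 - g u.2).
  by move=> c [p a] [p1 a1] /=; rewrite !linearPZ addrACA -scalerDr.
pose d := pack_linear lin_d.
have lin_p : linear (fun k : kernel d => (ker_incl d k).1) by move=> c u v.
have lin_a : linear (fun k : kernel d => (ker_incl d k).2) by move=> c u v.
have [b | h hK] := projP _ _ (pack_linear lin_p) (idfun : {linear P -> P}).
  have [a ga] := surj b.
  have /ker_inclP[k dk] : d (b, a) = 0 by apply/eqP; rewrite subr_eq0 /= ga.
  by exists k; rewrite -[LHS]/(ker_incl d k).1 dk.
exists (pack_linear lin_a \o h) => p /=.
have /eqP := ker_inclK (h p); rewrite /= subr_eq0 => /eqP <-.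
by congr (f _); exact: hK.
Qed.

Lemma projective_retract (P : lmodType R) A (i : {linear A -> P})
    (r : {linear P -> A}) : cancel i r -> projective P -> projective A.
Proof.
move=> ir projP B C g f surj.
have [h hP] := projP _ _ g (f \o r) surj.
by exists (h \o i) => a; rewrite /= hP /= ir.
Qed.

Lemma projective_prod (P Q : lmodType R) :
  projective P -> projective Q -> projective (P * Q)%type.
Proof.
move=> projP projQ B C g f surj.
have lin1 : linear (fun p : P => (p, 0 : Q)).
  by move=> c u v; congr pair; rewrite /= scaler0 addr0.
have lin2 : linear (fun q : Q => (0 : P, q)).
  by move=> c u v; congr pair; rewrite /= scaler0 addr0.
have [h1 h1P] := projP _ _ g (f \o pack_linear lin1) surj.
have [h2 h2P] := projQ _ _ g (f \o pack_linear lin2) surj.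
have lin_h : linear (fun u : P * Q => h1 u.1 + h2 u.2).
  by move=> c u v /=; rewrite !linearPZ scalerDr addrACA.
exists (pack_linear lin_h) => -[p q] /=.
rewrite linearD h1P h2P /= -linearD; congr (f _).
by congr pair; rewrite /= ?addr0 ?add0r.
Qed.

Lemma projective_row n : projective 'rV[R]_n.
Proof.
move=> A B g f surj.
have [a aP] := choice (fun j : 'I_n => surj (f (delta_mx 0 j))).
have lin_h : linear (fun v : 'rV[R]_n => \sum_j v 0 j *: a j).
  move=> c u v; rewrite scaler_sumr -big_split; apply: eq_bigr => j _.
  by rewrite !mxE scalerDl scalerA.
exists (pack_linear lin_h) => v /=; rewrite [in RHS](row_sum_delta v) !linear_sum.
by apply: eq_bigr => j _; rewrite !linearZ aP.
Qed.

Lemma finitely_generatedP A :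
  finitely_generated A <->
  exists n (e : {linear 'rV[R]_n -> A}), forall a, exists v, e v = a.
Proof.
split=> [[n [g gP]] | [n [e eP]]].
  have lin_e : linear (fun v : 'rV[R]_n => \sum_j v 0 j *: g j).
    move=> c u v; rewrite scaler_sumr -big_split; apply: eq_bigr => j _.
    by rewrite !mxE scalerDl scalerA.
  exists n, (pack_linear lin_e) => a; have [c ->] := gP a.
  by exists (\row_j c j); apply: eq_bigr => j _; rewrite mxE.
exists n, (fun j => e (delta_mx 0 j)) => a; have [v <-] := eP a.
exists (v 0); rewrite {1}(row_sum_delta v) linear_sum.
by apply: eq_bigr => j _; rewrite linearZ.
Qed.

End LinearMaps.

(** * Vanishing of Ext *)

Arguments res_proj {R M} p i _ _ _ _ _.

Section Vanishing.
Variable R : comNzRingType.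
Implicit Types M N : lmodType R.

Definition cohomology_zero M (P : proj_resolution M) i N : Prop :=
  forall f : {linear P i -> N}, cocycle f -> coboundary f.

Lemma res_diffK M (P : proj_resolution M) i x :
  res_diff P i (res_diff P i.+1 x) = 0.
Proof. by apply/res_exact; exists x. Qed.

Lemma res_augK M (P : proj_resolution M) x : res_aug P (res_diff P 0 x) = 0.
Proof. by apply/res_exact0; exists x. Qed.

(** Two projective resolutions of [M] are homotopy equivalent. Each degree is
    treated alone, and the homotopy identity is recorded on boundaries only:
    its other term vanishes there, so that degree [i] suffices to build degree
    [i.+1] and no chain map has to be chosen as a whole. *)
Lemma comparison M (P Q : proj_resolution M) i :
  exists (a : {linear P i -> Q i}) (b : {linear Q i -> P i})
         (s : {linear P i -> P i.+1}),
  [/\ forall x, exists y, res_diff Q i y = a (res_diff P i x),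
      forall y, exists x, res_diff P i x = b (res_diff Q i y) &
      forall x, res_diff P i (s (res_diff P i x)) =
        res_diff P i x - b (a (res_diff P i x))].
Proof.
elim: i => [|i [a [b [s [aP bP sP]]]]].
  have [a aP] := @lift_projective _ _ _ _ (res_aug Q) (res_aug P) (res_proj P 0)
    (fun x => res_aug_surj Q (res_aug P x)).
  have [b bP] := @lift_projective _ _ _ _ (res_aug P) (res_aug Q) (res_proj Q 0)
    (fun x => res_aug_surj P (res_aug Q x)).
  have [x | s sP] := @lift_projective _ _ _ _ (res_diff P 0)
    (idfun \- (b \o a) : {linear _ -> _}) (res_proj P 0).
    by apply/res_exact0; rewrite /= linearB bP aP subrr.
  exists a, b, s; split=> [x | y | x]; last by rewrite sP.
  - by apply/res_exact0; rewrite aP res_augK.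
  - by apply/res_exact0; rewrite bP res_augK.
have [a' a'P] := @lift_projective _ _ _ _ (res_diff Q i) (a \o res_diff P i)
  (res_proj P i.+1) aP.
have [b' b'P] := @lift_projective _ _ _ _ (res_diff P i) (b \o res_diff Q i)
  (res_proj Q i.+1) bP.
have [x | s' s'P] := @lift_projective _ _ _ _ (res_diff P i.+1)
  ((idfun \- (b' \o a')) \- (s \o res_diff P i) : {linear _ -> _})
  (res_proj P i.+1).
  by apply/res_exact; rewrite /= !linearB b'P /= a'P /= sP subrr.
exists a', b', s'; split=> [x | y | x].
- by apply/res_exact; rewrite a'P /= res_diffK linear0.
- by apply/res_exact; rewrite b'P /= res_diffK linear0.
- by rewrite s'P /= res_diffK linear0 subr0.
Qed.

(** Transport along the homotopy equivalence: a cocycle on [P] becomes one on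
    [Q], bounds there, and comes back as a coboundary up to the homotopy. *)
Lemma Ext_zeroP M N i (P : proj_resolution M) :
  Ext_zero i.+1 M N <-> cohomology_zero P i.+1 N.
Proof.
split=> [[Q vanQ] f cf | vanP]; last by exists P.
have [a [b [s [aP bP sP]]]] := comparison P Q i.
have [a' a'P] := @lift_projective _ _ _ _ (res_diff Q i) (a \o res_diff P i)
  (res_proj P i.+1) aP.
have [b' b'P] := @lift_projective _ _ _ _ (res_diff P i) (b \o res_diff Q i)
  (res_proj Q i.+1) bP.
have [y | e eP] := vanQ (f \o b').
  have [|x xP] := (res_exact (b' (res_diff Q i.+1 y))).1.
    by rewrite b'P /= res_diffK linear0.
  by rewrite /= -xP cf.
exists ((e \o a) \+ (f \o s) : {linear _ -> _}) => x.
have [|y yP] := (res_exact (x - b' (a' x) - s (res_diff P i x))).1.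
  by rewrite !linearB b'P /= a'P /= sP subrr.
have /eqP := cf y; rewrite yP !linearB subr_eq0 subr_eq /= => /eqP ->.
by rewrite addrC; congr (_ + _); have /= -> := eP (a' x); rewrite a'P.
Qed.

Record short_exact (A B C : lmodType R) (i : {linear A -> B})
    (p : {linear B -> C}) : Prop := ShortExact {
  se_inj : injective i;
  se_surj : forall c, exists b, p b = c;
  se_exact : forall b, p b = 0 <-> exists a, i a = b
}.

(** The parts of the long exact sequence of Ext(M, -) that are used, each one
    by a chase in a fixed projective resolution of [M]. *)
Section LongExact.
Variables (M A B C : lmodType R) (i : {linear A -> B}) (p : {linear B -> C}).
Hypothesis ex : short_exact i p.

Let pi (a : A) : p (i a) = 0. Proof. by apply/(se_exact ex); exists a. Qed.

Let p_shift (b : B) (a : A) : p (b - i a) = p b.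
Proof. by rewrite linearB pi subr0. Qed.

Lemma Ext_zero_quotient n :
  Ext_zero n.+1 M B -> Ext_zero n.+2 M A -> Ext_zero n.+1 M C.
Proof.
move=> [P vanB] /(Ext_zeroP _ _ P) vanA; exists P => f cf.
have [f' f'P] := @lift_projective _ _ _ _ p f (res_proj P n.+1)
  (fun x => se_surj ex _).
have [x | k kP] := @lift_injective _ _ _ _ i (f' \o res_diff P n.+1) (se_inj ex).
  by apply/(se_exact ex); rewrite f'P cf.
have [x | l lP] := vanA k.
  by apply: (se_inj ex); rewrite kP /= res_diffK !linear0.
have [x | e eP] := vanB (f' \- (i \o l) : {linear _ -> _}).
  by rewrite /= -lP kP subrr.
by exists (p \o e) => x; rewrite -f'P /= -eP; exact/esym/p_shift.
Qed.

Lemma Ext_zero_sub n :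
  Ext_zero n.+1 M C -> Ext_zero n.+2 M B -> Ext_zero n.+2 M A.
Proof.
move=> [P vanC] /(Ext_zeroP _ _ P) vanB; exists P => f cf.
have [x | e eP] := vanB (i \o f); first by rewrite /= cf linear0.
have [x | e' e'P] := vanC (p \o e); first by rewrite /= -eP pi.
have [e2 e2P] := @lift_projective _ _ _ _ p e' (res_proj P n)
  (fun x => se_surj ex _).
have [x | l lP] := @lift_injective _ _ _ _ i
    (e \- (e2 \o res_diff P n) : {linear _ -> _}) (se_inj ex).
  by apply/(se_exact ex); rewrite linearB /= e2P -e'P subrr.
exists l => x; apply: (se_inj ex).
by rewrite lP /= res_diffK linear0 subr0 -eP.
Qed.

Lemma Ext_zero_middle n :
  Ext_zero n.+1 M A -> Ext_zero n.+1 M C -> Ext_zero n.+1 M B.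
Proof.
move=> [P vanA] /(Ext_zeroP _ _ P) vanC; exists P => f cf.
have [x | e eP] := vanC (p \o f); first by rewrite /= cf linear0.
have [e' e'P] := @lift_projective _ _ _ _ p e (res_proj P n)
  (fun x => se_surj ex _).
have [x | k kP] := @lift_injective _ _ _ _ i
    (f \- (e' \o res_diff P n) : {linear _ -> _}) (se_inj ex).
  by apply/(se_exact ex); rewrite linearB /= e'P -eP subrr.
have [x | l lP] := vanA k.
  by apply: (se_inj ex); rewrite kP /= cf res_diffK !linear0 addr0.
exists (e' \+ (i \o l) : {linear _ -> _}) => x.
by rewrite /= -lP kP /= addrC subrK.
Qed.

End LongExact.

Lemma ker_short_exact (A B : lmodType R) (p : {linear A -> B}) :
  (forall b, exists a, p a = b) -> short_exact (ker_incl p) p.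
Proof.
by move=> surj; split=> // [|a]; [exact: ker_incl_inj | exact: ker_inclP].
Qed.

Lemma Ext_zero_prod i M (A B : lmodType R) :
  Ext_zero i.+1 M (A * B)%type <-> Ext_zero i.+1 M A /\ Ext_zero i.+1 M B.
Proof.
split=> [[P vanP] | [[P vanA] /(Ext_zeroP _ _ P) vanB]]; last first.
  exists P => f cf.
  have [x | e1 e1P] := vanA (fst \o f); first by rewrite /= cf.
  have [x | e2 e2P] := vanB (snd \o f); first by rewrite /= cf.
  have lin_e : linear (fun x => (e1 x, e2 x)).
    by move=> c u v; congr pair; rewrite /= linearPZ.
  exists (pack_linear lin_e) => x.
  by rewrite [LHS]surjective_pairing /= -e1P -e2P.
split; exists P => f cf.
  have lin_f : linear (fun x => (f x, 0 : B)).
    by move=> c u v; congr pair; rewrite /= ?linearPZ // scaler0 addr0.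
  have [x | e eP] := vanP (pack_linear lin_f); first by congr pair; exact: cf.
  by exists (fst \o e) => x; rewrite /= -eP.
have lin_f : linear (fun x => (0 : A, f x)).
  by move=> c u v; congr pair; rewrite /= ?linearPZ // scaler0 addr0.
have [x | e eP] := vanP (pack_linear lin_f); first by congr pair; exact: cf.
by exists (snd \o e) => x; rewrite /= -eP.
Qed.

Lemma Ext_zero_row i M n :
  Ext_zero i.+1 M R^o -> Ext_zero i.+1 M 'rV[R]_n.
Proof.
move=> [P vanP]; exists P => f cf.
have ex j : exists e : {linear P i -> R^o}, forall x, f x 0 j = e (res_diff P i x).
  have lin_f : linear (fun x => f x 0 j : R^o).
    by move=> c u v; rewrite linearPZ !mxE.
  have [x | e eP] := vanP (pack_linear lin_f); last by exists e => x; rewrite -eP.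
  by rewrite /= cf mxE.
have [e eP] := choice ex.
have lin_e : linear (fun x => \row_j (e j x)).
  by move=> c u v; apply/rowP => j; rewrite !mxE linearPZ.
by exists (pack_linear lin_e) => x; apply/rowP => j; rewrite eP mxE.
Qed.

Lemma proj_dim_Ext_zero n M N : proj_dim_le n M -> Ext_zero_above n M N.
Proof.
move=> [P P0] [|i] // ni; exists P => f _; exists \0 => x.
by rewrite /= (P0 _ ni x) linear0.
Qed.

(** * Truncating and splicing resolutions *)

Section Truncate.
Variables (M : lmodType R) (P : proj_resolution M).

Lemma truncate_subproof : exists e : {linear P 1 -> kernel (res_aug P)},
  forall x, ker_incl (res_aug P) (e x) = res_diff P 0 x.
Proof.
apply: lift_injective; first exact: ker_incl_inj.
by move=> x; apply/ker_inclP; rewrite res_augK.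
Qed.

Let aug := projT1 (cid truncate_subproof).
Let augP := projT2 (cid truncate_subproof).

Definition truncate : proj_resolution (kernel (res_aug P)).
Proof.
refine (@ProjResolution R _ (fun i => P i.+1) (fun i => res_diff P i.+1) aug
  (fun i => res_proj P i.+1) _ _ (fun i => @res_exact _ _ P i.+1)).
- move=> k; have [x xP] := (res_exact0 _).1 (ker_inclK k).
  by exists x; apply: ker_incl_inj; rewrite augP.
- move=> x; rewrite -(@res_exact _ _ P 0) -augP.
  by split=> [-> | H]; [rewrite linear0 | apply: ker_incl_inj; rewrite H linear0].
Defined.
End Truncate.

Lemma Ext_zero_truncate i M N (P : proj_resolution M) :
  Ext_zero i.+2 M N -> Ext_zero i.+1 (kernel (res_aug P)) N.
Proof. by move=> /(Ext_zeroP _ _ P) vanP; exists (truncate P). Qed.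

Section Splice.
Variables (M P0 : lmodType R) (e : {linear P0 -> M}).
Hypotheses (projP0 : projective P0) (e_surj : forall m, exists p, e p = m).
Variables (K : lmodType R) (i : {linear K -> P0}).
Hypothesis ex : short_exact i e.
Variable Q : proj_resolution K.

Definition splice_mod n : lmodType R := if n is n'.+1 then Q n' else P0.

Definition splice_diff n : {linear splice_mod n.+1 -> splice_mod n} :=
  match n with
  | 0 => i \o res_aug Q
  | n'.+1 => res_diff Q n'
  end.

Definition splice : proj_resolution M.
Proof.
refine (@ProjResolution R _ splice_mod splice_diff e _ e_surj _ _).
- by case=> [|n]; [exact: projP0 | exact: res_proj].
- move=> x; rewrite (se_exact ex); split=> [[k <-] | [y <-]]; last by exists (res_aug Q y).
  by have [y <-] := res_aug_surj Q k; exists y.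
- case=> [|n] x; last exact: res_exact.
  rewrite -res_exact0; split=> [ix | Qx].
    by apply: (se_inj ex); rewrite linear0.
  by rewrite -[LHS]/(i (res_aug Q x)) Qx linear0.
Defined.
End Splice.

End Vanishing.

(** * Ideals *)

Section Ideals.
Variable R : comNzRingType.

Definition ideal_like (I : R -> Prop) : Prop :=
  I 0 /\ forall a u v, I u -> I v -> I (a * u + v).

Lemma idealr_of_pred (I : R -> Prop) :
  ideal_like I -> ~ I 1 -> exists J : idealr R, forall x, x \in (J : pred R) <-> I x.
Proof.
move=> [I0 Ilin] I1; pose J : pred R := fun x => `[< I x >].
have idJ : idealr_closed J.
  split=> [||a u v]; rewrite ?unfold_in; try exact/asboolP.
  by move=> /asboolP Iu /asboolP Iv; apply/asboolP/Ilin.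
pose J' : idealr R := HB.pack J (isIdealr.Build R J idJ).
by exists J' => x; split=> /asboolP.
Qed.

Lemma noetherian_ideal (I : R -> Prop) : noetherian R -> ideal_like I ->
  exists n (g : 'I_n -> R), forall x, I x <-> ideal_span g x.
Proof.
move=> noeth idI; have [I1 | I1] := EM (I 1).
  exists 1, (fun=> 1) => x; split=> [_ | _].
    by exists (fun=> x); rewrite big_ord1 mulr1.
  by have := idI.2 x 1 0 I1 idI.1; rewrite addr0 mulr1.
have [J JP] := idealr_of_pred idI I1; have [n [g gP]] := noeth J.
by exists n, g => x; rewrite -JP gP.
Qed.

(** By Zorn's lemma a non-unit lies in a maximal ideal, hence in [m]. *)
Lemma local_unit (m : idealr R) (y : R) :
  local_ring m -> y \notin (m : pred R) -> exists z, y * z = 1.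
Proof.
move=> [_ m_uniq] /negP ym; have [//|ny] := EM (exists z, y * z = 1).
(* The empty set is admitted as the upper bound of the empty chain. *)
pose good (S : set R) := S = set0 \/ [/\ ideal_like S, ~ S 1 & S y].
have [F Fgood Ftot|S [Sgood Smax]] := @Zorn_bigcup R good.
  have [[X FX Xy]|none] := EM (exists2 X, F X & X y); last first.
    left; apply/seteqP; split=> // x [X FX Xx].
    have [X0|[_ _ Xy]] := Fgood _ FX; first by rewrite X0 in Xx.
    by case: none; exists X.
  have nonempty Z x : F Z -> Z x -> [/\ ideal_like Z, ~ Z 1 & Z y].
    by move=> /Fgood[->|].
  right; split; last by exists X.
  - split=> [|a u v [U FU Uu] [V FV Vv]].
      by exists X => //; case: (nonempty _ _ FX Xy) => -[].
    have [UV|VU] := Ftot U V FU FV.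
      by exists V => //; have [[_ + _ _]] := nonempty _ _ FV Vv; apply=> //; exact: UV.
    by exists U => //; have [[_ + _ _]] := nonempty _ _ FU Uu; apply=> //; exact: VU.
  - by move=> [Z FZ Z1]; case: (nonempty _ _ FZ Z1).
have span_y : good (fun x => exists a, x = a * y).
  right; split.
  - split=> [|a u v [b ->] [c ->]]; first by exists 0; rewrite mul0r.
    by exists (a * b + c); rewrite mulrDl mulrA.
  - by move=> [a ay]; apply: ny; exists a; rewrite mulrC.
  - by exists 1; rewrite mul1r.
have [S0|[idS S1 Sy]] := Sgood.
  case: (Smax _ _ span_y); rewrite S0; split=> // /(_ y); apply.
  by exists 1; rewrite mul1r.
have [J JP] := idealr_of_pred idS S1.
have maxJ : maximal_ideal J.
  move=> L JL x Lx; apply/JP; apply: contrapT => Sx.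
  have not_good := Smax (fun z => z \in (L : pred R)); apply: not_good.
    split=> [z /JP /JL // |] /(_ x Lx) //.
  right; split.
  - split=> [|a u v Lu Lv] /=; first exact: rpred0.
    by rewrite rpredD // idealMr.
  - by rewrite /= idealr1.
  - exact/JL/JP.
by case: ym; rewrite -(m_uniq J maxJ); apply/JP.
Qed.

Lemma unit_det_congr1 (m : idealr R) n (x : R) (A : 'M[R]_n) :
  local_ring m -> x \in (m : pred R) -> exists z, \det (1%:M - x *: A) * z = 1.
Proof.
move=> locR mx; apply: local_unit locR _.
pose q := \pi_({ideal_quot m})%qT : {rmorphism R -> {ideal_quot m}}.
have q0 u : q u = 0 <-> u \in (m : pred R).
  rewrite -[u in X in _ <-> X]subr0 Quotient.idealrBE -[0](rmorph0 q).
  by split=> [->|/eqP].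
apply/negP => /q0; rewrite -det_map_mx.
have -> : map_mx q (1%:M - x *: A) = 1%:M.
  apply/matrixP => i j; rewrite !mxE rmorphB rmorphM (q0 x).2 //.
  by rewrite mul0r subr0 rmorph_nat.
by rewrite det1 => /eqP; rewrite oner_eq0.
Qed.

(** The determinant of [1 - x S] is congruent to 1 modulo [m], hence a unit. *)
Lemma unipotent_row (m : idealr R) n (x : R) (S : {linear 'rV[R]_n -> 'rV[R]_n}) :
  local_ring m -> x \in (m : pred R) ->
  (forall v, v - x *: S v = 0 -> v = 0) /\ (forall w, exists v, v - x *: S v = w).
Proof.
move=> locR mx; pose B := 1%:M - x *: lin1_mx S.
have BE v : v - x *: S v = v *m B.
  by rewrite mulmxBr mulmx1 -scalemxAr mul_rV_lin1.
have [z Bz] := unit_det_congr1 (lin1_mx S) locR mx; rewrite -/B in Bz.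
split=> [v | w].
  rewrite BE => /(congr1 (fun u => z *: (u *m \adj B))).
  rewrite mul0mx scaler0 -mulmxA mul_mx_adj mul_mx_scalar scalerA mulrC Bz.
  by rewrite scale1r.
exists (z *: (w *m \adj B)); rewrite BE -scalemxAl -mulmxA mul_adj_mx.
by rewrite mul_mx_scalar scalerA mulrC Bz scale1r.
Qed.

End Ideals.

(** * Finite free resolutions *)

Section FreeResolutions.
Variable R : comNzRingType.
Hypothesis noeth : noetherian R.

(** Submodules of a finite free module are row spaces of matrices, by induction
    on the rank: the first coordinates form an ideal, and the vectors with first
    coordinate 0 form a submodule in smaller rank. *)
Lemma noetherian_row n (S : 'rV[R]_n -> Prop) :
  S 0 -> (forall a u v, S u -> S v -> S (a *: u + v)) ->
  exists k (A : 'M[R]_(k, n)), forall v, S v <-> exists c : 'rV_k, v = c *m A.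
Proof.
elim: n S => [|n IH] S S0 Slin.
  exists 0, 0 => v; split=> [_ | _]; last by rewrite thinmx0.
  by exists 0; rewrite thinmx0 [RHS]thinmx0.
rewrite -[n.+1]/(1 + n)%N in S S0 Slin *.
have [|k1 [g gP]] := @noetherian_ideal R (fun a => exists2 v, S v & v 0 0 = a) noeth.
  split=> [|a _ _ [u Su <-] [v Sv <-]]; first by exists 0; rewrite ?mxE.
  by exists (a *: u + v); [exact: Slin | rewrite !mxE].
have lift_g j : exists v, S v /\ v 0 0 = g j.
  have /gP[v Sv vg] : ideal_span g (g j); last by exists v.
  exists (fun i => (i == j)%:R); rewrite (bigD1 j) //= eqxx mul1r.
  by rewrite big1 ?addr0 // => i /negPf ->; rewrite mul0r.
have [w wP] := choice lift_g.
have [||k2 [A2 A2P]] := IH (fun v => S (row_mx 0 v)).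
- by rewrite row_mx0.
- move=> a u v Su Sv; have := Slin a _ _ Su Sv.
  by rewrite scale_row_mx add_row_mx scaler0 addr0.
pose A1 : 'M_(k1, 1 + n) := \matrix_j w j.
have SA1 c : S (c *m A1).
  rewrite mulmx_sum_row; elim/big_ind: _ => // [u v Su Sv | j _].
    by have := Slin 1 _ _ Su Sv; rewrite scale1r.
  rewrite rowK -[_ *: _]addr0; apply: Slin => //; exact: (wP j).1.
exists (k1 + k2)%N, (col_mx A1 (row_mx 0 A2)) => v; split=> [Sv | [c ->]].
  have /gP[c cP] : exists2 u, S u & u 0 0 = v 0 0 by exists v.
  pose u := v - (\row_j c j) *m A1.
  have Su : S u by rewrite /u addrC -scaleN1r; apply: Slin.
  have uE : u = row_mx 0 (rsubmx u).
    rewrite -[LHS]hsubmxK; congr row_mx; apply/rowP => i; rewrite ord1 !mxE.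
    rewrite (_ : lshift n 0 = 0); last exact: val_inj.
    rewrite cP; apply/eqP; rewrite subr_eq0; apply/eqP; apply: eq_bigr => j _.
    by rewrite !mxE (wP j).2.
  have /A2P[d dP] : S (row_mx 0 (rsubmx u)) by rewrite -uE.
  exists (row_mx (\row_j c j) d); rewrite mul_row_col mul_mx_row mulmx0 -dP -uE.
  by rewrite /u addrC subrK.
rewrite -[c]hsubmxK mul_row_col mul_mx_row mulmx0 -[_ *m A1]scale1r.
by apply: Slin => //; apply/A2P; exists (rsubmx c).
Qed.

Lemma noetherian_kernel n (M : lmodType R) (e : {linear 'rV[R]_n -> M}) :
  finitely_generated (kernel e).
Proof.
have [||k [A AP]] := @noetherian_row n (fun v => e v = 0); first exact: linear0.
  by move=> a u v eu ev; rewrite linearPZ eu ev scaler0 addr0.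
apply/finitely_generatedP; exists k.
have lin_A : linear (fun c : 'rV[R]_k => c *m A).
  by move=> a u v; rewrite mulmxDl scalemxAl.
have [c | h hP] := @lift_injective _ _ _ _ (ker_incl e) (pack_linear lin_A)
  (@ker_incl_inj _ _ _ e).
  by apply/ker_inclP/AP; exists c.
exists h => v; have /AP[c cP] := ker_inclK v.
by exists c; apply: ker_incl_inj; rewrite hP cP.
Qed.

(** Coordinates on the terms serve three times: for determinants, for the rank
    of the pullback and for its finite generation. *)
Record free_resolution (M : lmodType R) := FreeResolution {
  fr_rank : nat -> nat;
  fr_diff : forall i, {linear 'rV[R]_(fr_rank i.+1) -> 'rV[R]_(fr_rank i)};
  fr_aug : {linear 'rV[R]_(fr_rank 0) -> M};
  fr_aug_surj : forall m, exists x, fr_aug x = m;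
  fr_exact0 : forall x, fr_aug x = 0 <-> exists y, fr_diff 0 y = x;
  fr_exact : forall i (x : 'rV[R]_(fr_rank i.+1)),
    fr_diff i x = 0 <-> exists y, fr_diff i.+1 y = x
}.

Definition proj_of_free M (F : free_resolution M) : proj_resolution M :=
  @ProjResolution R M (fun i => 'rV[R]_(fr_rank F i)) (fr_diff F) (fr_aug F)
    (fun i => @projective_row R _) (@fr_aug_surj _ F) (@fr_exact0 _ F)
    (@fr_exact _ F).

(** Bundling makes taking syzygies an endofunction, which can be iterated. *)
Record fg_module := FgModule { fg_mod : lmodType R; fg_fg : finitely_generated fg_mod }.

Definition cover_rank (X : fg_module) : nat :=
  projT1 (cid ((finitely_generatedP _).1 (fg_fg X))).
Definition cover_sig (X : fg_module) :=
  cid (projT2 (cid ((finitely_generatedP _).1 (fg_fg X)))).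
Definition cover (X : fg_module) : {linear 'rV[R]_(cover_rank X) -> fg_mod X} :=
  projT1 (cover_sig X).
Lemma cover_surj X m : exists v, cover X v = m.
Proof. exact: projT2 (cover_sig X) m. Qed.

Definition syzygy (X : fg_module) : fg_module :=
  FgModule (noetherian_kernel (cover X)).

Lemma free_resolution_exists (M : lmodType R) :
  finitely_generated M -> inhabited (free_resolution M).
Proof.
move=> fgM; pose Z i := iter i syzygy (FgModule fgM); constructor.
apply: (@FreeResolution M (fun i => cover_rank (Z i))
  (fun i => ker_incl (cover (Z i)) \o cover (Z i.+1)) (cover (Z 0))).
- exact: (@cover_surj (Z 0)).
- move=> x; rewrite ker_inclP; split=> [[k <-] | [y <-]]; last by exists (cover (Z 1) y).
  by have [y <-] := @cover_surj (Z 1) k; exists y.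
- move=> i x; split=> [ix | [y <-]]; last first.
    pose k := cover (Z i.+2) y.
    by rewrite -[LHS]/(ker_incl _ (cover (Z i.+1) (ker_incl _ k))) ker_inclK linear0.
  have /ker_inclP[k <-] : cover (Z i.+1) x = 0.
    by apply: (@ker_incl_inj _ _ _ (cover (Z i))); rewrite linear0.
  by have [y <-] := @cover_surj (Z i.+2) k; exists y.
Qed.

End FreeResolutions.

(** * The pullback of a free cover along multiplication by a scalar *)

Section Pullback.
Variables (R : comNzRingType) (M : lmodType R) (P : proj_resolution M) (x : R).

Lemma pull_subproof :
  linear (fun u : P 0 * M => res_aug P u.1 - x *: u.2).
Proof.
move=> c [p m] [p' m'] /=; rewrite linearPZ scalerDr opprD addrACA scalerBr.
by rewrite !scalerA mulrC.
Qed.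

Definition pull_map := pack_linear pull_subproof.

Definition pullback : lmodType R := kernel pull_map.

Definition pull_free : {linear pullback -> P 0} := fst \o ker_incl pull_map.
Definition pull_base : {linear pullback -> M} := snd \o ker_incl pull_map.

Lemma pull_eq (u : pullback) : res_aug P (pull_free u) = x *: pull_base u.
Proof. by apply/eqP; rewrite -subr_eq0; apply/eqP; exact: (ker_inclK u). Qed.

Lemma pull_inj u v :
  pull_free u = pull_free v -> pull_base u = pull_base v -> u = v.
Proof.
move=> e1 e2; apply: (@ker_incl_inj _ _ _ pull_map).
by apply/eqP; rewrite -pair_eqE; apply/andP; split; apply/eqP.
Qed.

Lemma pull_lift (A : lmodType R) (f : {linear A -> P 0}) (g : {linear A -> M}) :
  (forall a, res_aug P (f a) = x *: g a) ->
  exists h : {linear A -> pullback},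
    (forall a, pull_free (h a) = f a) /\ (forall a, pull_base (h a) = g a).
Proof.
move=> fg; have lin_fg : linear (fun a => (f a, g a)).
  by move=> c u v; congr pair; rewrite /= linearPZ.
have [a | h hP] := @lift_injective _ _ _ _ (ker_incl pull_map)
    (pack_linear lin_fg) (@ker_incl_inj _ _ _ _).
  by apply/ker_inclP; rewrite -[LHS]/(res_aug P (f a) - x *: g a) fg subrr.
exists h; split=> a; first by rewrite -[LHS]/(ker_incl pull_map (h a)).1 hP.
by rewrite -[LHS]/(ker_incl pull_map (h a)).2 hP.
Qed.


Lemma pull_sub_exists : exists k : {linear kernel (res_aug P) -> pullback},
  (forall a, pull_free (k a) = ker_incl (res_aug P) a) /\
  (forall a, pull_base (k a) = 0).
Proof.
by apply: (pull_lift (g := \0)) => a; rewrite ker_inclK scaler0.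
Qed.

(** The pullback of the class of [0 -> K -> P 0 -> M -> 0] along [x]. *)
Lemma pull_short_exact :
  exists k : {linear kernel (res_aug P) -> pullback}, short_exact k pull_base.
Proof.
have [k [k1 k2]] := pull_sub_exists; exists k; split=> [a b kab | m | u].
- by apply: (@ker_incl_inj _ _ _ (res_aug P)); rewrite -!k1 kab.
- have [p pP] := res_aug_surj P (x *: m).
  have lin1 : linear (fun c : R^o => c *: p).
    by move=> c a b; rewrite scalerDl scalerA.
  have lin2 : linear (fun c : R^o => c *: m).
    by move=> c a b; rewrite scalerDl scalerA.
  have [c | h [_ h2]] := pull_lift (f := pack_linear lin1) (g := pack_linear lin2).
    by rewrite /= linearZ /= pP !scalerA mulrC.
  by exists (h 1); rewrite h2 /= scale1r.
- split=> [u0 | [a <-]]; last exact: k2.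
  have /ker_inclP[a aP] : res_aug P (pull_free u) = 0 by rewrite pull_eq u0 scaler0.
  by exists a; apply: pull_inj; rewrite ?k1 ?k2.
Qed.

(** Multiplication by [x] on [M] lifts to multiplication by [x] on [P]. The
    mapping cone of the latter, without its term of degree 0, resolves the
    pullback; for [x] regular on [M] the whole cone resolves [M / x M], whose
    first syzygy is then the pullback. *)
Definition cone_mod i : lmodType R := (P i.+1 * P i)%type.

Lemma cone_diff_subproof i : linear (fun u : cone_mod i.+1 =>
  (res_diff P i.+1 u.1 + x *: u.2, - res_diff P i u.2) : cone_mod i).
Proof.
move=> c [p q] [p' q']; congr pair; rewrite /= !linearPZ.
  by rewrite addrACA -scalerDr.
by [].
Qed.
Definition cone_diff i : {linear cone_mod i.+1 -> cone_mod i} :=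
  pack_linear (@cone_diff_subproof i).

Lemma cone_aug_subproof : exists h : {linear cone_mod 0 -> pullback},
  (forall u, pull_free (h u) = res_diff P 0 u.1 + x *: u.2) /\
  (forall u, pull_base (h u) = res_aug P u.2).
Proof.
have lin1 : linear (fun u : cone_mod 0 => res_diff P 0 u.1 + x *: u.2).
  move=> c [p q] [p' q']; rewrite /= !linearPZ.
  by rewrite addrACA -scalerDr.
have lin2 : linear (fun u : cone_mod 0 => res_aug P u.2).
  by move=> c [p q] [p' q']; rewrite /= !linearPZ.
apply: (@pull_lift _ (pack_linear lin1) (pack_linear lin2)) => -[p q] /=.
by rewrite linearD res_augK add0r linearZ.
Qed.
Let aug := projT1 (cid cone_aug_subproof).
Let aug1 : forall u, pull_free (aug u) = res_diff P 0 u.1 + x *: u.2 :=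
  (projT2 (cid cone_aug_subproof)).1.
Let aug2 : forall u, pull_base (aug u) = res_aug P u.2 :=
  (projT2 (cid cone_aug_subproof)).2.

Definition cone : proj_resolution pullback.
Proof.
refine (@ProjResolution R _ cone_mod cone_diff aug _ _ _ _).
- by move=> i; apply: projective_prod; exact: res_proj.
- move=> u; have [q qP] := res_aug_surj P (pull_base u).
  have [|p pP] := (res_exact0 (pull_free u - x *: q)).1.
    by rewrite linearB linearZ /= qP pull_eq subrr.
  by exists (p, q); apply: pull_inj; rewrite ?aug1 ?aug2 //= pP subrK.
- move=> [p q]; split=> [u0 | [[p' q'] <-]].
    have /res_exact0[q' q'P] : res_aug P q = 0.
      by rewrite -[q]/((p, q).2) -aug2 u0 linear0.
    have [|p' p'P] := (res_exact (p + x *: q')).1.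
      rewrite linearD linearZ /= q'P.
      by have := aug1 (p, q); rewrite u0 linear0 => /= <-.
    exists (p', - q'); congr pair; rewrite /=.
      by rewrite p'P scalerN addrK.
    by rewrite linearN opprK.
  apply: pull_inj; rewrite linear0 ?aug1 ?aug2 /=.
    by rewrite linearD linearZ res_diffK add0r /= scalerN subrr.
  by rewrite linearN res_augK oppr0.
- move=> i [p q]; split=> [u0 | [[p' q'] <-]].
    have /res_exact[q' q'P] : res_diff P i q = 0.
      by have /eqP := congr1 snd u0; rewrite /= oppr_eq0 => /eqP.
    have [|p' p'P] := (res_exact (p + x *: q')).1.
      rewrite linearD linearZ /= q'P.
      by have := congr1 fst u0.
    exists (p', - q'); congr pair; rewrite /=.
      by rewrite p'P scalerN addrK.
    by rewrite linearN opprK.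
  congr pair; rewrite /=.
    by rewrite linearD linearZ res_diffK add0r /= scalerN subrr.
  by rewrite linearN res_diffK !oppr0.
Defined.

(** The first component of a cocycle on the cone is a cocycle on [P], say the
    coboundary of [g1]; subtracting [x g1] makes the second one a cocycle. *)
Lemma Ext_zero_pullback n N :
  Ext_zero n.+1 M N -> Ext_zero n.+2 M N -> Ext_zero n.+1 pullback N.
Proof.
move=> /(Ext_zeroP _ _ P) van1 /(Ext_zeroP _ _ P) van2; exists cone => f cf.
have lin1 : linear (fun p : P n.+2 => f (p, 0)).
  move=> c u v; rewrite -linearPZ; congr (f _).
  by congr pair; rewrite /= scaler0 addr0.
have lin2 : linear (fun q : P n.+1 => f (0, q)).
  move=> c u v; rewrite -linearPZ; congr (f _).
  by congr pair; rewrite /= scaler0 addr0.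
have fE p q : f (p, q) = pack_linear lin1 p + pack_linear lin2 q.
  by rewrite /= -linearD; congr (f _); congr pair; rewrite /= ?addr0 ?add0r.
have [p | g1 g1P] := van2 (pack_linear lin1).
  rewrite -(cf (p, 0)) /=; congr (f _); congr pair; rewrite /=.
    by rewrite scaler0 addr0.
  by rewrite linear0 oppr0.
have [q | g2 g2P] := van1 (pack_linear lin2 \- (x \*: g1) : {linear _ -> _}).
  have := cf (0, q); rewrite [X in f X](_ : _ = (x *: q, - res_diff P n.+1 q)).
    rewrite fE g1P !linearZ linearN /= => /eqP.
    by rewrite subr_eq0 => /eqP <-; rewrite subrr.
  by congr pair; rewrite /= linear0 add0r.
have lin_g : linear (fun u : cone_mod n => g1 u.1 - g2 u.2).
  move=> c [p q] [p' q'] /=; rewrite !linearPZ addrACA -scalerDr //.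
exists (pack_linear lin_g) => -[p q].
rewrite fE g1P /= linearD linearN opprK -g2P linearZ /= -addrA.
by congr (_ + _); rewrite addrC subrK.
Qed.

End Pullback.

(** * Projectivity from the rigidity of the pullback *)

Section Core.
Variables (R : comNzRingType) (m : idealr R) (R_local : local_ring m).
Variables (M : lmodType R) (F : free_resolution M).
Let P := proj_of_free F.
Variable x : R.
Hypothesis mx : x \in (m : pred R).

(** Let [K = ker eps]. The cocycle [f : (p, q) |-> (d q, 0)] of the cone
    represents the image of the class of [0 -> K -> P 0 -> M -> 0] under the map
    Ext^1(M, K) -> Ext^1(X, X) given by [X -> M] and [K -> X]. That it bounds says
    [(d q, 0) = x g1 q - g2 (d q)] with [g1] a cocycle on [P], so the component
    of [g1] in [P 0] is [e \o d] by Ext^1(M, P 0) = 0. Comparing the components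
    in [P 0], the map [x e - pull_free \o g2] is the identity on [K]; comparing
    those in [M], its image under [eps] is [x sigma] with [sigma] vanishing on
    [K]. Subtracting [x S], for a lift [S] of [sigma], gives [r : P 0 -> K],
    equal to [1 - x S] on [K]. *)
Lemma projective_of_rigid_pullback :
  Ext_zero 1 M R^o -> Ext_zero 1 (pullback P x) (pullback P x) -> projective M.
Proof.
move=> /(@Ext_zero_row _ _ _ (fr_rank F 0)) /(Ext_zeroP _ _ P) vanR.
move=> /(Ext_zeroP _ _ (cone P x)) vanX.
pose d := res_diff P 0; pose eps := res_aug P.
have lin_f : linear (fun u : cone_mod P 1 => d u.2) by move=> c u v; rewrite linearPZ.
have [u | f [f1 f2]] := pull_lift (x := x) (f := pack_linear lin_f) (g := \0).
  by rewrite scaler0 [LHS]res_augK.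
have [u | g gP] := vanX f.
  apply: pull_inj; rewrite ?f1 ?f2 linear0 //=.
  by rewrite linearN [res_diff P 0 _]res_diffK oppr0.
have lin1 : linear (fun p : P 1 => g (p, 0)).
  move=> c u v; rewrite -linearPZ; congr (g _).
  by congr pair; rewrite /= scaler0 addr0.
have lin2 : linear (fun q : P 0 => g (0, q)).
  move=> c u v; rewrite -linearPZ; congr (g _).
  by congr pair; rewrite /= scaler0 addr0.
pose g1 := pack_linear lin1; pose g2 := pack_linear lin2.
have gE p q : g (p, q) = g1 p + g2 q.
  by rewrite /= -linearD; congr (g _); congr pair; rewrite /= ?addr0 ?add0r.
have g_eq q : f (0, q) = x *: g1 q - g2 (d q).
  rewrite gP -[cone_diff _ _ _ _]/(res_diff P 1 0 + x *: q, - d q) gE.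
  by rewrite linear0 add0r linearZ linearN.
have [p | e eP] := vanR (pull_free P x \o g1).
  have := gP (p, 0); rewrite [X in g X](_ : _ = (res_diff P 1 p, 0)).
    move=> /(congr1 (pull_free P x)); rewrite f1 /= => <-.
    by rewrite /d linear0.
  by congr pair; rewrite /= ?scaler0 ?addr0 // linear0 oppr0.
pose sigma : {linear P 0 -> M} := (eps \o e) \- (pull_base P x \o g2).
have sigma_d q : sigma (d q) = 0.
  rewrite /= -eP /= [eps _]pull_eq.
  have := congr1 (pull_base P x) (g_eq q).
  by rewrite f2 linearB linearZ.
have [S SP] := @lift_projective _ _ _ _ eps sigma (res_proj P 0)
  (fun v => res_aug_surj P _).
(* [S] maps [K] to itself; [C] is a lift of that endomorphism to [P 1]. *)
have [q | C CP] := @lift_projective _ _ _ _ d (S \o d) (res_proj P 1).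
  by apply/res_exact0; rewrite [LHS]SP sigma_d.
pose r : {linear P 0 -> P 0} :=
  ((x \*: e) \- (pull_free P x \o g2)) \- (x \*: S).
have eps_r v : eps (r v) = 0.
  rewrite -[r v]/(x *: e v - pull_free P x (g2 v) - x *: S v).
  rewrite !linearB !linearZ /= SP [eps (pull_free _ _ _)]pull_eq -scalerBr.
  by rewrite -scalerDr -[X in X + _]/(sigma v) subrr scaler0.
have r_d q : r (d q) = d q - x *: S (d q).
  have h : d q = x *: pull_free P x (g1 q) - pull_free P x (g2 (d q)).
    by rewrite -linearZ -linearB -g_eq f1.
  rewrite [X in _ = X - _]h.
  by rewrite -[pull_free P x (g1 q)]/((pull_free P x \o g1) q) eP.
(* [1 - x S] is injective on [K] since it is so on [P 0], and surjective on [K]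
   since [1 - x C] is so on [P 1]. *)
have [S_inj _] := unipotent_row S R_local mx.
have [_ C_surj] := unipotent_row C R_local mx.
(* As [r] restricts to a bijection of [K], each class of [P 0] modulo [K] has a
   unique member in the kernel of [r]: this is the section of [eps]. *)
have [a | c a p a' p' [] | p [] | s sP] :=
  @linear_of_relation _ _ _ (fun a p => eps p = a /\ r p = 0).
- have [p0 p0P] := res_aug_surj P a.
  have [q0 q0P] := (res_exact0 _).1 (eps_r p0).
  have [q qP] := C_surj q0.
  exists (p0 - d q); split; first by rewrite linearB p0P [eps _]res_augK subr0.
  rewrite linearB r_d -[r p0]q0P -qP.
  by rewrite linearB linearZ /= -/d [d (C q)]CP subrr.
- by move=> <- rp [<- rp']; rewrite !linearPZ rp rp' scaler0 addr0.
- move=> /res_exact0[q <-]; rewrite -/d r_d; exact: S_inj.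
apply: (@projective_retract _ (P 0) M s eps) (res_proj P 0).
by move=> a; have [] := sP a.
Qed.

End Core.

(** * The pullback has constant rank *)

Section Rank.
Variables (R : comNzRingType) (p : prime_idealr R).

Lemma common_denominator n (s : 'I_n -> denominator p) :
  exists t : denominator p, forall j, exists c, den t = c * den (s j).
Proof.
have prod_notin : \prod_j den (s j) \notin (p : pred R).
  elim/big_ind: _ => [|a b pa pb|j _]; last exact: den_notin.
    by rewrite idealr1.
  by rewrite prime_idealrM negb_or pa.
exists (Denominator prod_notin) => j.
by exists (\prod_(i | i != j) den (s i)); rewrite /= (bigD1 j) //= mulrC.
Qed.

Variables (M : lmodType R) (F : free_resolution M) (x : R).
Let P := proj_of_free F.
Hypothesis px : x \notin (p : pred R).
Let n := fr_rank F 0.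
Let dx : denominator p := Denominator px.

Let row_of (u : pullback P x) : 'rV[R]_n := pull_free P x u.

(** The localization at [p] of the projection [X -> P 0]: it is bijective, for
    an element [(v, w)] of [X] satisfies [w = eps v / x] at [p]. *)
Definition rank_map (z : localization p (pullback P x)) : 'rV[localized_ring p]_n :=
  \row_j ring_frac (row_of (repr z).1 0 j) (repr z).2.

Lemma rank_mapE u s :
  rank_map (loc_frac u s) = \row_j ring_frac (row_of u 0 j) s.
Proof.
apply/rowP => j; rewrite !mxE; have [w] := repr_loc_frac u s.
move=> /(congr1 (fun v => row_of v 0 j)); rewrite /row_of !linearZ !mxE => E.
by apply/ring_fracP; exists w.
Qed.

Lemma rank_map_linear : linear rank_map.
Proof.
elim/ring_ind => a s; elim/loc_ind => u t; elim/loc_ind => v w.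
rewrite loc_fracZ loc_fracD !rank_mapE; apply/rowP => j; rewrite !mxE.
by rewrite -[ring_frac a s * _]/(ring_mul _ _) ring_mulE ring_addE.
Qed.

Lemma rank_map_inj : injective rank_map.
Proof.
elim/loc_ind => u s; elim/loc_ind => v t; rewrite !rank_mapE => E.
have ex j : exists w : denominator p,
    den w * (den t * row_of u 0 j) = den w * (den s * row_of v 0 j).
  by apply/ring_fracP; have := congr1 (fun r : 'rV_n => r 0 j) E; rewrite !mxE.
have [w wP] := choice ex; have [d dP] := common_denominator w.
have free_eq : den d *: (den t *: row_of u) = den d *: (den s *: row_of v).
  apply/rowP => j; rewrite !mxE; have [c ->] := dP j.
  by rewrite -!mulrA wP.
(* [d] makes the components in [P 0] agree; a further factor [x] takes care of
   those in [M], as [x w = eps v]. *)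
apply/loc_fracP; exists (denominatorM d dx) => /=; apply: (@pull_inj _ _ P x).
  rewrite !linearZ /= mulrC -2!(scalerA x); congr (_ *: _); exact: free_eq.
have baseE (a : R) (q : pullback P x) : (den d * x) *: (a *: pull_base P x q) =
    res_aug P (den d *: (a *: row_of q)).
  by rewrite !linearZ /= [res_aug P _]pull_eq !scalerA; congr (_ *: _); ring.
by rewrite !linearZ /= !baseE free_eq.
Qed.

Lemma rank_map_surj y : exists z, rank_map z = y.
Proof.
have ex j : exists as_ : R * denominator p, y 0 j = ring_frac as_.1 as_.2.
  by elim/ring_ind: (y 0 j) => a s; exists (a, s).
have [f fP] := choice ex.
have [d dP] := common_denominator (fun j => (f j).2).
have [c cP] := choice dP.
pose v : P 0 := \row_j (c j * (f j).1).
have [q | h [h1 h2]] := @pull_lift R M P x (P 0) (x \*: idfun) (res_aug P).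
  by rewrite linearZ.
exists (loc_frac (h v) (denominatorM d dx)); rewrite rank_mapE.
apply/rowP => j; rewrite mxE fP /row_of h1; apply/ring_fracP.
by exists (denominator1 p); rewrite /= !mxE (cP j); ring.
Qed.

Lemma pullback_rank :
  exists f : {linear localization p (pullback P x) -> 'rV[localized_ring p]_n},
    bijective f.
Proof.
have [g gP] := choice rank_map_surj.
exists (pack_linear rank_map_linear); exists g => // z.
by apply: rank_map_inj; rewrite gP.
Qed.

End Rank.

Lemma regular_notin_associated (R : comNzRingType) (p : prime_idealr R) (x : R) :
  (forall a, a * x = 0 -> a = 0) -> associated_prime p -> x \notin (p : pred R).
Proof.
move=> regx [y yP]; apply/negP; rewrite yP mulrC => /eqP /regx y0.
by have := yP 1; rewrite y0 mulr0 eqxx idealr1.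
Qed.

Lemma pullback_constant_rank (R : comNzRingType) (M : lmodType R)
    (F : free_resolution M) (x : R) :
  (forall a, a * x = 0 -> a = 0) -> constant_rank (pullback (proj_of_free F) x).
Proof.
move=> regx; exists (fr_rank F 0) => p ap.
exact/pullback_rank/(regular_notin_associated regx).
Qed.

Lemma depth_regular_element (R : comNzRingType) (m : idealr R) d :
  has_depth m d -> (0 < d)%N ->
  exists2 x, x \in (m : pred R) & forall a, a * x = 0 -> a = 0.
Proof.
move=> [[a [[reg _] ma]] _] d_gt0; pose i := Ordinal d_gt0.
exists (a i) => // y yx; have [|c ->] := reg i y; last by rewrite big_ord0.
by exists (fun=> 0); rewrite yx big_ord0.
Qed.

(** * Rigid modules and the four conditions *)

Section Conditions.
Variables (R : comNzRingType) (m : idealr R).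
Hypotheses (noeth : noetherian R) (R_local : local_ring m).
Implicit Types M N : lmodType R.

Lemma pullback_fg M (F : free_resolution M) x :
  finitely_generated (pullback (proj_of_free F) x).
Proof.
set P := proj_of_free F; apply/finitely_generatedP.
exists (fr_rank F 1 + fr_rank F 0)%N.
have lin : linear (fun v : 'rV[R]_(fr_rank F 1 + fr_rank F 0) =>
    res_aug (cone P x) (lsubmx v, rsubmx v)).
  move=> c u v; rewrite -linearPZ; congr (res_aug _ _).
  by congr pair; rewrite linearPZ.
exists (pack_linear lin) => u; have [[v w] <-] := res_aug_surj (cone P x) u.
by exists (row_mx v w); rewrite /= row_mxKl row_mxKr.
Qed.

(** [X] is an extension of [M] by [K], and Ext^{i+1}(M, K) vanishes along with
    Ext^i(M, M); so Ext^i(M, X) vanishes for large [i], hence Ext^i(X, X). *)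
Lemma eventually_pullback M (F : free_resolution M) x :
  let X := pullback (proj_of_free F) x in
  Ext_zero_above 0 M R^o -> Ext_zero_eventually M M -> Ext_zero_eventually X X.
Proof.
set P := proj_of_free F => X MR [n MM].
have [k ex] := pull_short_exact P x.
have MK i : (n.+1 < i)%N -> Ext_zero i M (kernel (res_aug P)).
  case: i => [|[|i]] // ni.
  apply: (Ext_zero_sub (ker_short_exact (res_aug_surj P))); first exact: MM.
  by apply: Ext_zero_row; exact: MR.
have MX i : (n.+1 < i)%N -> Ext_zero i M X.
  case: i => [|i] // ni; apply: (Ext_zero_middle ex); first exact: MK.
  by apply: MM; exact: ltn_trans ni.
by exists n.+1 => -[|i] // ni; apply: Ext_zero_pullback; apply: MX => //; exact: ltnW.
Qed.

(** (SAC) and (SACC) enter only through what they say about the pullback. *)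
Lemma projective_of_pullback_condition M x :
  finitely_generated M -> Ext_zero_above 0 M R^o -> Ext_zero_eventually M M ->
  x \in (m : pred R) ->
  (forall F : free_resolution M, let X := pullback (proj_of_free F) x in
    finitely_generated X -> Ext_zero_above 0 X R^o -> Ext_zero_eventually X X ->
    Ext_zero_above 0 X X) ->
  projective M.
Proof.
move=> fgM MR MM mx cond; have [F] := free_resolution_exists noeth fgM.
apply: (projective_of_rigid_pullback R_local (F := F) mx); first exact: MR.
apply: cond => //; first exact: pullback_fg; last exact: eventually_pullback.
by case=> [|i] // _; apply: Ext_zero_pullback; exact: MR.
Qed.

(** Applied to a syzygy of [N], the bound [b.+1] gives the bound [b] for [N]. *)
Lemma Ext_zero_of_uniform_bound b M :
  Ext_zero_above 0 M R^o ->
  (forall N, finitely_generated N -> Ext_zero_eventually M N -> Ext_zero_above b M N) ->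
  forall N, finitely_generated N -> Ext_zero_eventually M N -> Ext_zero_above 0 M N.
Proof.
move=> MR; elim: b => [//|b IH bound]; apply: IH => N fgN [n MN] [|i] // bi.
have [k [e e_surj]] := (finitely_generatedP N).1 fgN.
have ex := ker_short_exact e_surj.
have MF j : Ext_zero j.+1 M 'rV[R]_k by apply: Ext_zero_row; exact: MR.
apply: (Ext_zero_quotient ex (MF i)); apply: bound => //.
  exact: noetherian_kernel.
by exists n.+1 => -[|[|j]] // nj; apply: (Ext_zero_sub ex) => //; exact: MN.
Qed.

Definition zero_resolution : proj_resolution 'rV[R]_0.
Proof.
refine (@ProjResolution R _ (fun=> 'rV[R]_0) (fun=> idfun) idfun
  (fun=> @projective_row R 0) _ _ _) => [v | v | _ v]; first by exists v.
- by rewrite [v]thinmx0; split=> // _; exists 0.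
- by rewrite [v]thinmx0; split=> // _; exists 0.
Defined.

Lemma projective_proj_dim M : projective M -> proj_dim_le 0 M.
Proof.
move=> projM.
have ex : short_exact (\0 : {linear 'rV[R]_0 -> M}) (idfun : {linear M -> M}).
  split=> [u v _ | c | b]; [by rewrite [u]thinmx0 [v]thinmx0 | by exists c |].
  by split=> [/= -> | [a /= <-]] //; exists 0.
exists (splice projM (@se_surj _ _ _ _ _ _ ex) ex zero_resolution) => -[|i] // _ v.
exact: thinmx0.
Qed.

(** The n-th syzygy of [M] is rigid, hence projective. *)
Lemma proj_dim_of_rigid n M :
  (forall N, finitely_generated N -> Ext_zero_above 0 N R^o ->
     Ext_zero_eventually N N -> projective N) ->
  finitely_generated M -> Ext_zero_above n M R^o -> Ext_zero_eventually M M ->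
  proj_dim_le n M.
Proof.
move=> rigid; elim: n M => [|n IH] M fgM MR MM.
  exact/projective_proj_dim/rigid.
have [F] := free_resolution_exists noeth fgM; pose P := proj_of_free F.
have ex := ker_short_exact (res_aug_surj P).
have [|||Q Q0] := IH (kernel (res_aug P)).
- exact: noetherian_kernel.
- by case=> [|i] // ni; apply: Ext_zero_truncate; exact: MR.
- case: MM => k MM; exists (maxn k n.+1) => -[|i] //; rewrite gtn_max => /andP[ki ni].
  apply: Ext_zero_truncate; apply: (Ext_zero_sub ex); first exact: MM.
  by apply: Ext_zero_row; apply: MR; exact: ltn_trans ni _.
exists (splice (res_proj P 0) (res_aug_surj P) ex Q) => -[|i] // ni v.
exact: Q0.
Qed.

Lemma SAC_rigid M : cond_SAC R -> finitely_generated M ->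
  Ext_zero_above 0 M R^o -> Ext_zero_eventually M M -> projective M.
Proof.
move=> sac fgM MR MM.
apply: (projective_of_pullback_condition fgM MR MM (idealr0 m)) => F X.
exact: sac.
Qed.

Lemma SACC_rigid M x : cond_SACC R -> x \in (m : pred R) ->
  (forall a, a * x = 0 -> a = 0) -> finitely_generated M ->
  Ext_zero_above 0 M R^o -> Ext_zero_eventually M M -> projective M.
Proof.
move=> sacc mx regx fgM MR MM.
apply: (projective_of_pullback_condition fgM MR MM mx) => F X fgX.
exact/sacc/pullback_constant_rank.
Qed.

End Conditions.

Theorem theorem1p2 (R : comNzRingType) (m : idealr R)
    (R_noetherian : noetherian R) (R_local : local_ring m) :
  (cond_AC R -> cond_SAC R) /\
  (cond_SAC R <-> cond_GARC R) /\
  (cond_SAC R -> cond_SACC R) /\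
  ((exists2 d : nat, has_depth m d & (0 < d)%N) -> cond_SACC R -> cond_ARC R).
Proof.
split=> [AC M fgM MR MM|].
  have [b bound] := AC M fgM.
  exact: (Ext_zero_of_uniform_bound R_noetherian MR bound fgM MM).
split; first split=> [SAC M fgM n MMR | GARC M fgM MR [n MM]].
- have MM : Ext_zero_above n M M by case=> [|i] // ni; have /Ext_zero_prod[] := MMR _ ni.
  apply: (proj_dim_of_rigid R_noetherian) fgM _ _; last by exists n.
    by move=> N fgN NR NN; exact: (SAC_rigid R_noetherian R_local SAC fgN NR NN).
  by case=> [|i] // ni; have /Ext_zero_prod[] := MMR _ ni.
- have pd : proj_dim_le n M.
    apply: GARC => // -[|i] // ni; apply/Ext_zero_prod; split; first exact: MM.
    exact: MR.
  apply: (Ext_zero_of_uniform_bound R_noetherian MR _ fgM); last by exists n.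
  by move=> N _ _; exact: proj_dim_Ext_zero pd.
split=> [SAC M fgM _ | [d depth d_gt0] SACC M fgM MMR]; first exact: SAC.
have [x mx regx] := depth_regular_element depth d_gt0.
apply: (SACC_rigid R_noetherian R_local SACC mx regx fgM); last exists 0;
  by case=> [|i] // ni; have /Ext_zero_prod[] := MMR _ ni.
Qed.
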